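(* Let $W$ be a nondeterministic recursive probabilistic program (given by its control-flow graph) with a sampling function $\Upsilon$. For every ranking measure function $h$ for $W$ with corresponding constant $\epsilon\in(0,\infty)$, and for every stack element $\mathfrak c=(f,\ell,\nu)$ of $W$, $$\overline T(\mathfrak c)\le\frac{h(\mathfrak c)}{\epsilon}.$$
   Context: **Programs.** For a finite set $V$ of variables, $\mathrm{Val}_V$ is the set of functions (valuations) $V\to\mathbb Z$. A nondeterministic recursive probabilistic program $W$ is represented by its control-flow graph: a finite set $F$ of function names, a finite set $V_r$ of sampling variables and, for each $f\in F$: a finite set $V^f$ of program variables (write $\mathrm{Val}_f:=\mathrm{Val}_{V^f}$); a finite set $L^f$ of labels partitioned into branching labels $L_b^f$, assignment labels $L_a^f$, call labels $L_c^f$ and nondeterministic labels $L_d^f$; an initial label $\ell_{in}^f\in L^f$ and a terminal label $\ell_{out}^f\in L^f$ with $\ell_{in}^f\ne\ell_{out}^f$; and a set $\to_f$ of triples (source label, decoration, target label). For each $\ell\in L^f\setminus\{\ell_{out}^f\}$ the triples with source $\ell$ are: - if $\ell\in L_a^f$: exactly one triple $(\ell,u,\ell')$ with update function $u:\mathrm{Val}_f\times\mathrm{Val}_{V_r}\to\mathrm{Val}_f$; - if $\ell\in L_c^f$: exactly one triple $(\ell,(g,v),\ell')$ with $g\in F$ and value-passing function $v:\mathrm{Val}_f\to\mathrm{Val}_g$; - if $\ell\in L_b^f$: exactly two triples $(\ell,\phi,\ell_1),(\ell,\neg\phi,\ell_2)$ with $\phi$ a propositional arithmetic predicate over $V^f$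 (Boolean combination of comparisons of integer-valued arithmetic expressions); - if $\ell\in L_d^f$: exactly two triples $(\ell,\star,\ell_1),(\ell,\star,\ell_2)$ (the then-branch and the else-branch, respectively). **Sampling.** A sampling function $\Upsilon$ assigns to each $r\in V_r$ a discrete probability distribution on $\mathbb Z$; $\overline\Upsilon(\mu):=\prod_{r\in V_r}\Upsilon(r)(\mu(r))$ for $\mu\in\mathrm{Val}_{V_r}$, and $\mathrm{Val}^r:=\{\mu:\overline\Upsilon(\mu)>0\}$. **Semantics.** A stack element is a triple $(f,\ell,\nu)$ with $f\in F$, $\ell\in L^f$, $\nu\in\mathrm{Val}_f$; it is terminal if $\ell=\ell_{out}^f$. $\mathcal E$ is the set of stack elements. A configuration is a finite word (possibly the empty word $\varepsilon$) of non-terminal stack elements, the first letter being the top of the stack. For a stack element $\mathfrak d$ let $[\mathfrak d]$ be the one-letter word $\mathfrak d$ if $\mathfrak d$ is non-terminal and $\varepsilon$ otherwise. States are pairs $(w,\mu)$ of a configuration and $\mu\in\mathrm{Val}_{V_r}$. In one step from $((f,\ell,\nu)\cdot w,\mu)$, $\mu'$ is drawn with probability $\overline\Upsilon(\mu')$ and the next state is $(w',\mu')$ where - assignment: $w'=[(f,\ell',u(\nu,\mu'))]\cdot w$; - call: $w'=(g,\ell_{in}^g,v(\nu))\cdot[(f,\ell',\nu)]\cdot w$; - branching: $w'=[(f,\ell_1,\nu)]\cdot w$ if $\nu\models\phi$, and $w'=[(f,\ell_2,\nu)]\cdot w$ otherwise; - nondeterministic: $w'=[(f,\ell_1,\nu)]\cdot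 w$ under action $\mathbf{th}$ and $w'=[(f,\ell_2,\nu)]\cdot w$ under action $\mathbf{el}$. From $(\varepsilon,\mu)$ the next state is $(\varepsilon,\mu')$ with probability $\overline\Upsilon(\mu')$. In non-nondeterministic states there is effectively a single action $\tau$; when the top label is nondeterministic the enabled actions are $\mathbf{th},\mathbf{el}$. A history is a finite nonempty sequence of states in which each consecutive pair has positive transition probability under some action. A scheduler $\sigma$ maps every history to a probability distribution over the actions enabled at its last state. For a scheduler $\sigma$ and a non-terminal stack element $\mathfrak c$, $\mathbb P^\sigma_{\mathfrak c}$ (expectation $\mathbb E^\sigma_{\mathfrak c}$) is the induced probability measure on infinite sequences of states starting in $(\mathfrak c,\mathbf 0)$, where $\mathbf 0$ is the zero valuation. **Termination time.** $T(\{(w_n,\mu_n)\}_{n\ge0}):=\min\{n\ge 0: w_n=\varepsilon\}$ ($\min\emptyset=\infty$). $\overline T:\mathcal E\to[0,\infty]$ is $\overline T(\mathfrak c):=\sup_\sigma\mathbb E^\sigma_{\mathfrak c}(T)$ if $\mathfrak c$ is non-terminal (sup over all schedulers), and $\overline T(\mathfrak c):=0$ if terminal. **Ranking measure functions.** A ranking measure function for $W$ with corresponding constant $\epsilon\in(0,\infty)$ is a function $h:\mathcal E\to[0,\infty]$ such that for all stack elements $(f,\ell,\nu)$: - (C1) if $\ell=\ell_{out}^f$ then $h(f,\ell,\nu)=0$; - (C2) if $\ell\in L_a^f\setminus\{\ell_{out}^f\}$ and $(\ell,u,\ell')$ is the only triple in $\to_f$ with source $\ell$: $\epsilon+\sum_{\mu\in\mathrm{Val}^r}\overline\Upsilon(\mu)\,h(f,\ell',u(\nu,\mu))\le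 h(f,\ell,\nu)$; - (C3) if $\ell\in L_c^f\setminus\{\ell_{out}^f\}$ and $(\ell,(g,v),\ell')$ is the only triple in $\to_f$ with source $\ell$: $\epsilon+h(g,\ell_{in}^g,v(\nu))+h(f,\ell',\nu)\le h(f,\ell,\nu)$; - (C4) if $\ell\in L_b^f\setminus\{\ell_{out}^f\}$ and $(\ell,\phi,\ell_1),(\ell,\neg\phi,\ell_2)$ are the two triples in $\to_f$ with source $\ell$: $\mathbf 1_{\nu\models\phi}h(f,\ell_1,\nu)+\mathbf 1_{\nu\models\neg\phi}h(f,\ell_2,\nu)+\epsilon\le h(f,\ell,\nu)$; - (C5) if $\ell\in L_d^f\setminus\{\ell_{out}^f\}$ and $(\ell,\star,\ell_1),(\ell,\star,\ell_2)$ are the two triples in $\to_f$ with source $\ell$: $\max\{h(f,\ell_1,\nu),h(f,\ell_2,\nu)\}+\epsilon\le h(f,\ell,\nu)$. Conventions: $d\cdot\infty=\infty$ for $d\in(0,\infty]$, $0\cdot\infty=0$. *)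

(* Defs.v *)
From HB Require Import structures.
From mathcomp Require Import all_boot all_order all_algebra.
From mathcomp Require Import all_classical all_reals all_analysis.
Set Implicit Arguments.
Unset Strict Implicit.
Unset Printing Implicit Defensive.
Import Order.TTheory GRing.Theory Num.Theory.
Import numFieldNormedType.Exports.
Local Open Scope classical_set_scope.
Local Open Scope ring_scope.

(* Runs of a discrete-time process with countable state space T: the sample space
   is nat -> T with the sigma-algebra generated by the cylinders. *)

(* runs whose first (size s) states are s *)
Definition cylinder (T : Type) (s : seq T) : set (nat -> T) :=
  [set w | mkseq w (size s) = s].

Definition cylinders (T : Type) : set (set (nat -> T)) :=
  [set cylinder s | s in [set: seq T]].

Arguments cylinders : clear implicits.

Section unit_measure.
Context (d : measure_display) (T : measurableType d) (R : realType).
Context (mu : {measure set T -> \bar R}) (mu1 : mu setT = 1%E).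

(* mu1 is kept in the body for the inference of the probability structure. *)
Definition unit_measure : set T -> \bar R := let _ := mu1 in mu.

HB.instance Definition _ := Measure.on unit_measure.
HB.instance Definition _ :=
  Measure_isProbability.Build _ _ _ unit_measure mu1.

End unit_measure.

(* Extension theorem: a consistent family m of prefix probabilities over a
   countable state space is induced by a probability measure on runs. Each prefix
   s is assigned an interval I s of length m s, the intervals of the one-letter
   extensions of s partitioning I s; the measure is the law of the run followed by
   a uniformly distributed point of [0, 1[. *)
Section consistent_family.
Context (R : realType) (T : pointedType) (code : T -> nat).
Hypothesis code_inj : injective code.
Variable m : seq T -> R.
Hypothesis m_nil : m [::] = 1.
Hypothesis m_ge0 : forall s, 0 <= m s.
Hypothesis m_rcons :
  forall s, (\esum_(t in [set: T]) (m (rcons s t))%:E = (m s)%:E)%E.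

(* below s n : mass of the one-letter extensions of s with code < n *)
Let belowE s n := (\esum_(t in [set t | (code t < n)%N]) (m (rcons s t))%:E)%E.
Let below s n : R := fine (belowE s n).

Let esum_sub s (A B : set T) : A `<=` B ->
  (\esum_(t in A) (m (rcons s t))%:E <= \esum_(t in B) (m (rcons s t))%:E)%E.
Proof.
move=> AB; apply: ge_ereal_sup => _ [F [finF FA] <-].
by apply: esum_ge; exists F => //; split => //; apply: subset_trans AB.
Qed.

Let belowK s n : (below s n)%:E = belowE s n.
Proof.
rewrite /below fineK// ge0_fin_numE; last first.
  by apply: esum_ge0 => t _; rewrite lee_fin.
apply: (@le_lt_trans _ _ (m s)%:E); last by rewrite ltry.
by rewrite -m_rcons; apply: esum_sub.
Qed.

Let below_le s n : below s n <= m s.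
Proof. by rewrite -lee_fin belowK -m_rcons; apply: esum_sub. Qed.

Let below_mono s n n' : (n <= n')%N -> below s n <= below s n'.
Proof.
move=> nn'; rewrite -lee_fin !belowK; apply: esum_sub => t /= /leq_trans.
exact.
Qed.

Let below0 s : below s 0 = 0.
Proof. by apply: EFin_inj; rewrite belowK /belowE esum1. Qed.

Let belowS s t : below s (code t).+1 = below s (code t) + m (rcons s t).
Proof.
apply: EFin_inj; rewrite EFinD !belowK /belowE.
rewrite (esumID [set t' | (code t' < code t)%N]); last first.
  by move=> i _; rewrite lee_fin.
congr (_ + _)%E.
  congr (esum _ _); apply/seteqP; split=> [x /= []//|x /= xt].
  by split => //; exact: ltnW.
rewrite (_ : _ `&` _ = [set t]) ?esum_set1 ?lee_fin//.
apply/seteqP; split=> [x /= [+ /negP]|x /= ->]; last first.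
  by split=> //; rewrite ltnn.
rewrite ltnS -leqNgt => le1 le2.
by apply: code_inj; apply/eqP; rewrite eqn_leq le1 le2.
Qed.

Let belowS0 s n : (forall t, code t <> n) -> below s n.+1 = below s n.
Proof.
move=> H; apply: EFin_inj; rewrite !belowK /belowE; congr (esum _ _).
apply/seteqP; split=> x /=; rewrite ltnS; last exact: ltnW.
by rewrite leq_eqVlt => /orP[/eqP/H|].
Qed.

Let below_sup s y : y < m s -> exists n, y < below s n.
Proof.
rewrite -lte_fin -m_rcons => /ereal_sup_gt[_ [F [finF _] <-] yF].
have [X FX] := (finite_seqP F).1 finF.
exists (\max_(t <- X) code t).+1; rewrite -lte_fin belowK.
apply: (lt_le_trans yF); apply: esum_ge; exists F => //; split=> // t.
by rewrite FX /= ltnS => tX; exact: leq_bigmax_seq.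
Qed.

Let Fixpoint lft_from (p s : seq T) : R :=
  if s is t :: s' then below p (code t) + lft_from (rcons p t) s' else 0.
Let lft s := lft_from [::] s.

Let lft_rcons s t : lft (rcons s t) = lft s + below s (code t).
Proof.
rewrite /lft -[in below _ _](cat0s s); elim: s [::] => [|u s IH] p /=.
  by rewrite cats0 addr0 add0r.
by rewrite IH addrA -cats1 -catA.
Qed.

Let I s : set R := `[lft s, lft s + m s[%classic.

Let I_sub s t : I (rcons s t) `<=` I s.
Proof.
move=> x; rewrite /I /= !in_itv/= lft_rcons => /andP[h1 h2].
have b0 : 0 <= below s (code t) by rewrite -(below0 s); apply: below_mono.
apply/andP; split; first by apply: le_trans h1; rewrite lerDl.
by apply: (lt_le_trans h2); rewrite -addrA -belowS lerD2l below_le.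
Qed.

Let I_ex s x : I s x -> exists t, I (rcons s t) x.
Proof.
rewrite /I /= in_itv/= => /andP[h1 h2].
have /below_sup h : x - lft s < m s by rewrite ltrBlDl.
case: (ex_minnP h) => -[|n]; first by rewrite below0 subr_lt0 ltNge h1.
move=> hn hmin.
have hn' : below s n <= x - lft s.
  by rewrite leNgt; apply/negP => /hmin; rewrite ltnn.
have [[t tn]|nt] := pselect (exists t, code t = n); last first.
  have := belowS0 s (fun t tn => nt (ex_intro _ t tn)).
  by move=> e; move: hn; rewrite e ltNge hn'.
exists t; rewrite in_itv/= lft_rcons tn; apply/andP; split.
  by rewrite -lerBrDl.
by rewrite -tn -addrA -belowS tn -ltrBlDl.
Qed.

Let I_uniq s t t' x : I (rcons s t) x -> I (rcons s t') x -> t = t'.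
Proof.
rewrite /I /= !in_itv/= !lft_rcons -!addrA -!belowS.
move=> /andP[h1 h2] /andP[h3 h4]; apply: code_inj.
have lt_absurd (u v : T) : lft s + below s (code v) <= x ->
    x < lft s + below s (code u).+1 -> (code u < code v)%N -> False.
  move=> h h' uv; have := lt_le_trans h' (le_trans _ h).
  by rewrite lerD2l below_mono// ltxx => /(_ isT).
by case: (ltngtP (code t) (code t')) => // [/(lt_absurd _ _ h3 h2)|/(lt_absurd _ _ h1 h4)].
Qed.

Let next s x := xget point [set t | I (rcons s t) x].
Let Fixpoint pref x n : seq T :=
  if n is n'.+1 then rcons (pref x n') (next (pref x n') x) else [::].
Let walk (x : R) : nat -> T :=
  if x \in `[0, 1[ then fun n => next (pref x n) x else fun=> point.

Let I_nil : I [::] = `[0, 1[%classic.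
Proof. by rewrite /I /lft /= m_nil add0r. Qed.

Let I_pref x n : x \in `[0, 1[ -> I (pref x n) x.
Proof.
move=> x01; elim: n => [|n IH] /=; first by rewrite I_nil.
by rewrite /next; have /(xgetPex point) := I_ex IH.
Qed.

Let pref_I s x : I s x -> pref x (size s) = s.
Proof.
elim/last_ind: s => [//|s t IH Ix]; rewrite size_rcons /=.
rewrite IH; last exact: I_sub Ix.
congr rcons; apply: (@I_uniq s _ _ x) => //.
by have /(xgetPex point) : exists t, I (rcons s t) x by exists t.
Qed.

Let pref_mkseq x n : pref x n = mkseq (fun n => next (pref x n) x) n.
Proof.
elim: n => [//|n IH]; rewrite /= {1}IH /mkseq -addn1 iotaD map_cat /=.
by rewrite cats1.
Qed.

Let I_sub01 s : I s `<=` `[0, 1[%classic.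
Proof.
rewrite -I_nil; elim/last_ind: s => [//|s t IH].
exact: subset_trans (@I_sub s t) IH.
Qed.

Let walk_cyl s : `[0, 1[%classic `&` walk @^-1` cylinder s = I s.
Proof.
apply/seteqP; split=> [x [/= x01]|x Ix].
  rewrite /cylinder/= /walk ifT// -pref_mkseq => e; rewrite -e; exact: I_pref.
have x01 := I_sub01 Ix; split=> //=.
by rewrite /cylinder/= /walk ifT// -pref_mkseq pref_I.
Qed.

Let m01 : measurable (`[0, 1[%classic : set (measurableTypeR R)).
Proof. exact: measurable_itv. Qed.

Let Om := g_sigma_algebraType (cylinders T).

Let mwalk : measurable_fun setT (walk : measurableTypeR R -> Om).
Proof.
apply: (@measurability _ _ _ Om setT walk (cylinders T)) => //.
move=> _ [_ [s _ <-] <-]; rewrite setTI.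
rewrite -(setUIDK (walk @^-1` cylinder s) `[0, 1[%classic).
apply: measurableU; first by rewrite setIC walk_cyl; exact: measurable_itv.
have [h|h] := pselect (cylinder s (fun=> point)).
  rewrite (_ : _ `\` _ = ~` `[0, 1[%classic); first exact: measurableC.
  apply/seteqP; split=> [x []//|x /= x01]; split=> //.
  by rewrite /walk ifF//; apply/negP.
rewrite (_ : _ `\` _ = set0)//; apply/seteqP; split=> // x [/= + /negP/negbTE].
by rewrite /walk => + e; rewrite e.
Qed.

Let walk_mfun : {mfun measurableTypeR R >-> Om} :=
  HB.pack (walk : measurableTypeR R -> Om) (isMeasurableFun.Build _ _ _ _ _ mwalk).

Let P : set Om -> \bar R := pushforward (mrestr lebesgue_measure m01) walk_mfun.

Let P_cyl s : P (cylinder s) = (m s)%:E.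
Proof.
rewrite /P /pushforward /mrestr setIC walk_cyl lebesgue_measure_itv /=.
rewrite lte_fin ltrDl -EFinB addrAC subrr add0r.
by case: ltP => // ms0; congr EFin; apply/eqP; rewrite eq_le ms0 m_ge0.
Qed.

Let P0 : P set0 = 0%E. Proof. exact: measure0. Qed.

Let P_ge0 A : (0 <= P A)%E. Proof. exact: measure_ge0. Qed.

Let P_sigma_additive : semi_sigma_additive P.
Proof. exact: measure_semi_sigma_additive. Qed.

Let P_setT : P setT = 1%E.
Proof.
rewrite -[in RHS]m_nil -P_cyl; congr P; apply/seteqP; split => // w _.
Qed.

Lemma consistent_family_probability :
  exists P : probability Om R, forall s, P (cylinder s) = (m s)%:E.
Proof.
pose mP : {measure set Om -> \bar R} :=
  HB.pack P (isMeasure.Build _ _ _ P P0 P_ge0 P_sigma_additive).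
by exists (unit_measure (mu := mP) P_setT); exact: P_cyl.
Qed.

End consistent_family.

Lemma cylinder_probability_unique (R : realType) (T : pointedType)
    (P Q : probability (g_sigma_algebraType (cylinders T)) R) :
  (forall s, P (cylinder s) = Q (cylinder s)) ->
  forall A, measurable A -> P A = Q A.
Proof.
move=> PQ; pose G := cylinders T `|` [set set0].
have PT : P setT = Q setT by rewrite !probability_setT.
have mG : G `<=` @measurable _ (g_sigma_algebraType (cylinders T)).
  by move=> A [cA|->]; [exact: sub_sigma_algebra|exact: measurable0].
apply: (@measure_unique _ _ (g_sigma_algebraType (cylinders T)) G (fun=> setT)) => //.
- apply/seteqP; split; last first.
    by apply: smallest_sub => //; exact: sigma_algebra_measurable.
  apply: smallest_sub; first exact: smallest_sigma_algebra.
  by move=> A cA; apply: sub_sigma_algebra; left.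
- suff GI s s' : (size s <= size s')%N -> G (cylinder s `&` cylinder s').
    move=> A B [[s _ <-]|->]; last by rewrite set0I; right.
    move=> [[s' _ <-]|->]; last by rewrite setI0; right.
    by case/orP: (leq_total (size s) (size s')) => /GI; rewrite // setIC.
  move=> ss; have [e|ne] := pselect (take (size s) s' = s).
    left; exists s' => //; apply/seteqP; split=> [w ws'|w []//]; split=> //.
    rewrite /cylinder/= -[RHS]e -[in RHS]ws' /mkseq -map_take take_iota.
    by move/minn_idPl : ss => ->.
  right; rewrite /= -subset0 => w [ws ws']; apply: ne.
  rewrite -[in LHS]ws' -[RHS]ws /mkseq -map_take take_iota.
  by move/minn_idPl : ss => ->.
- by move=> _; left; exists [::] => //; apply/seteqP; split.
- by apply/seteqP; split => // w _; exists 0%N.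
- by move=> A [[s _ <-]|->]; [exact: PQ|rewrite !measure0].
- by move=> _ /=; rewrite [X in (X < _)%E](probability_setT P) ltry.
Qed.

Notation valuation V := {ffun V -> int}.

Inductive comparison := CLe | CLt | CEq.

(* An integer-valued arithmetic expression over V is represented by the
   function on valuations that it denotes. *)
Inductive predicate (V : finType) :=
| Cmp of comparison & (valuation V -> int) & (valuation V -> int)
| Neg of predicate V
| And of predicate V & predicate V
| Or of predicate V & predicate V.

Fixpoint sat (V : finType) (nu : valuation V) (phi : predicate V) : bool :=
  match phi with
  | Cmp CLe e1 e2 => e1 nu <= e2 nu
  | Cmp CLt e1 e2 => e1 nu < e2 nu
  | Cmp CEq e1 e2 => e1 nu == e2 nu
  | Neg phi1 => ~~ sat nu phi1
  | And phi1 phi2 => sat nu phi1 && sat nu phi2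
  | Or phi1 phi2 => sat nu phi1 || sat nu phi2
  end.

(* The triples of the control-flow graph with a given source label l:
     Assign u l'        (l, u, l')
     Call g v l'        (l, (g, v), l')
     Branch phi l1 l2   (l, phi, l1) and (l, Neg phi, l2)
     Nondet l1 l2       (l, star, l1) and (l, star, l2), then- and else-branch *)
Inductive instr (F Vr : finType) (pvar label : F -> finType) (f : F) :=
| Assign of (valuation (pvar f) -> valuation Vr -> valuation (pvar f))
    & label f
| Call (g : F) of (valuation (pvar f) -> valuation (pvar g)) & label f
| Branch of predicate (pvar f) & label f & label f
| Nondet of label f & label f.

(* The constructor of code f l tells which of the four classes of the partition
   of the labels l belongs to. The terminal label belongs to a class too, but
   nothing below reads the triples given by code f (lout f). *)
Record program := Program {
  fname : finType;
  svar : finType;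
  pvar : fname -> finType;
  label : fname -> finType;
  lin : forall f, label f;
  lout : forall f, label f;
  lin_lout : forall f, lin f != lout f;
  code : forall f, label f -> instr svar pvar label f
}.

Record sampling (R : realType) (W : program) := Sampling {
  pmf :> svar W -> int -> R;
  pmf_ge0 : forall r z, 0 <= pmf r z;
  pmf_sum1 : forall r, (\esum_(z in [set: int]) (pmf r z)%:E = 1)%E
}.

Definition joint (R : realType) (W : program) (Ups : sampling R W)
    (mu : valuation (svar W)) : R :=
  \prod_(r : svar W) Ups r (mu r).

Section semantics.
Variable W : program.

Definition stack_elem := {f : fname W & (label f * valuation (pvar f))%type}.
HB.instance Definition _ := Countable.on stack_elem.

Definition elem (f : fname W) (l : label f) (nu : valuation (pvar f)) :
  stack_elem := existT _ f (l, nu).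

Definition terminal (c : stack_elem) : bool := (tagged c).1 == lout (tag c).

Definition nt_elem := {c : stack_elem | ~~ terminal c}.
HB.instance Definition _ := Countable.on nt_elem.

Definition config := seq nt_elem.
HB.instance Definition _ := Countable.on config.

(* the word [c] *)
Definition word (c : stack_elem) : config :=
  if insub c is Some c' then [:: c'] else [::].

Lemma entry_proof (f : fname W) (nu : valuation (pvar f)) :
  ~~ terminal (elem (lin f) nu).
Proof. exact: lin_lout. Qed.

Definition entry (f : fname W) (nu : valuation (pvar f)) : nt_elem :=
  exist _ (elem (lin f) nu) (entry_proof nu).

Definition state := (config * valuation (svar W))%type.
HB.instance Definition _ := Countable.on state.
HB.instance Definition _ := isPointed.Build state ([::], 0).

Inductive action := Tau | Th | El.

Definition action_code (a : action) : option bool :=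
  match a with Tau => None | Th => Some true | El => Some false end.
Definition action_decode (b : option bool) : action :=
  match b with None => Tau | Some true => Th | Some false => El end.
Lemma action_codeK : cancel action_code action_decode.
Proof. by case. Qed.
HB.instance Definition _ := Finite.copy action (can_type action_codeK).

Definition exec (c : nt_elem) (a : action) (mu' : valuation (svar W)) :
    config :=
  let: existT f (l, nu) := val c in
  match code l with
  | Assign u l' => word (elem l' (u nu mu'))
  | Call g v l' => entry (v nu) :: word (elem l' nu)
  | Branch phi l1 l2 => word (elem (if sat nu phi then l1 else l2) nu)
  | Nondet l1 l2 => word (elem (if a is Th then l1 else l2) nu)
  end.

Definition succ (w : config) (a : action) (mu' : valuation (svar W)) : config :=
  if w is c :: w' then exec c a mu' ++ w' else [::].

Definition nondet_elem (c : stack_elem) : bool :=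
  let: existT f (l, _) := c in if code l is Nondet _ _ then true else false.

Definition nondet (x : state) : bool :=
  if x.1 is c :: _ then nondet_elem (val c) else false.

Definition enabled (x : state) : {pred action} :=
  [pred a | if nondet x then a != Tau else a == Tau].

Section sampled.
Variables (R : realType) (Ups : sampling R W).

Definition trans (x : state) (a : action) (y : state) : R :=
  if (a \in enabled x) && (y.1 == succ x.1 a y.2) then joint Ups y.2 else 0.

(* the states x :: s form a history *)
Definition history (x : state) (s : seq state) : bool :=
  path [rel y z | [exists a, 0 < trans y a z]] x s.

(* Values of a scheduler outside histories are irrelevant. *)
Record scheduler := Scheduler {
  choice_prob :> seq state -> action -> R;
  choice_prob_ge0 : forall x s, history x s ->
    forall a, 0 <= choice_prob (x :: s) a;
  choice_prob_enabled : forall x s, history x s ->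
    forall a, a \notin enabled (last x s) -> choice_prob (x :: s) a = 0;
  choice_prob_sum1 : forall x s, history x s ->
    \sum_a choice_prob (x :: s) a = 1
}.

Definition step_prob (sigma : scheduler) (x : state) (s : seq state)
    (y : state) : R :=
  \sum_a sigma (x :: s) a * trans (last x s) a y.

Definition init (c : nt_elem) : state := ([:: c], 0).

(* probability that the first (size s) states are s *)
Definition prefix_prob (sigma : scheduler) (c : nt_elem) (s : seq state) : R :=
  if s is x :: s' then
    (x == init c)%:R *
    \prod_(i < size s') step_prob sigma x (take i s') (nth x s' i)
  else 1.

Definition runs := g_sigma_algebraType (cylinders state).

End sampled.
End semantics.

Section total_mass.
Local Open Scope ereal_scope.

Lemma esum_scale (R : realType) (T : choiceType) (I : set T) (k : R)
    (a : T -> \bar R) : (0 <= k)%R -> (forall t, 0 <= a t) ->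
  \esum_(t in I) (k%:E * a t) = k%:E * \esum_(t in I) a t.
Proof.
move=> k0 a0; rewrite /esum -ereal_supZl//; last first.
  by apply/set0P; exists (\sum_(x \in set0) a x); exists set0 => //; exact: fsets_set0.
congr ereal_sup; apply/seteqP; split=> [_ [A AI <-]|_ [_ [A AI <-] <-]].
  by exists (\sum_(x \in A) a x); [exists A|rewrite ge0_mule_fsumr].
by exists A => //; rewrite ge0_mule_fsumr.
Qed.

(* The valuations vanishing outside the variables listed in s. *)
Let box (V : finType) (s : seq V) : set (valuation V) :=
  [set mu | forall v, v \notin s -> mu v = 0%R].

Lemma esum_prod_pmf (R : realType) (V : finType) (p : V -> int -> R) (s : seq V) :
  (forall v z, 0 <= p v z)%R -> (forall v, \esum_(z in [set: int]) (p v z)%:E = 1) ->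
  uniq s -> \esum_(mu in box s) (\prod_(v <- s) p v (mu v))%:E = 1.
Proof.
move=> p0 p1; elim: s => [_|v s IH /= /andP[vs us]].
  rewrite (_ : box [::] = [set [ffun=> 0%R]]).
    by rewrite esum_set1 big_nil.
  apply/seteqP; split=> [mu h|_ -> v _]; last by rewrite ffunE.
  by apply/ffunP => v; rewrite ffunE h.
pose upd (q : int * valuation V) : valuation V :=
  [ffun w => if w == v then q.1 else q.2 w].
rewrite (@reindex_esum _ _ _ ([set: int] `*` box s) _ upd); last first.
  split.
  - move=> [z mu] [_ h] w /=; rewrite inE negb_or => /andP[wv ws].
    by rewrite ffunE (negbTE wv) h.
  - move=> [z mu] [z' mu']; rewrite !inE => -[_ /= h] [_ /= h'] /ffunP e.
    have := e v; rewrite !ffunE eqxx /= => ->; congr (_, _).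
    apply/ffunP => w; have := e w; rewrite !ffunE.
    by case: eqP => //= -> _; rewrite h ?h'.
  - move=> mu h; exists (mu v, [ffun w => if w == v then 0%R else mu w]).
      split=> // w ws /=; rewrite ffunE; case: eqP => // /eqP wv.
      by apply: h; rewrite inE negb_or wv.
    by apply/ffunP => w; rewrite !ffunE /=; case: eqP => // ->.
transitivity (\esum_(z in [set: int]) \esum_(mu in box s)
    ((p v z)%:E * (\prod_(w <- s) p w (mu w))%:E)); last first.
  rewrite -[RHS](p1 v); apply: eq_esum => z _.
  by rewrite esum_scale ?IH ?mule1// => mu; rewrite lee_fin prodr_ge0.
rewrite esum_esum; last first.
  by move=> z mu _ _; rewrite -EFinM lee_fin mulr_ge0// prodr_ge0.
apply: eq_esum => -[z mu] _ /=; rewrite big_cons ffunE eqxx /= EFinM.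
congr (_ * (_)%:E); apply: eq_big_seq => w ws; rewrite ffunE.
by case: eqP => // e; move: vs; rewrite -e ws.
Qed.

Lemma joint_sum1 (R : realType) (W : program) (Ups : sampling R W) :
  \esum_(mu in [set: valuation (svar W)]) (joint Ups mu)%:E = 1.
Proof.
rewrite -(@esum_prod_pmf R (svar W) Ups (index_enum (svar W))).
- rewrite (_ : box _ = setT)//; apply/seteqP; split=> // mu _ v.
  by rewrite mem_index_enum.
- exact: pmf_ge0.
- exact: pmf_sum1.
- exact: index_enum_uniq.
Qed.

End total_mass.

Section run_probability.
Context (R : realType) (W : program) (Ups : sampling R W).
Implicit Types (x y : state W) (s : seq (state W)) (sigma : scheduler Ups).

Lemma joint_ge0 mu : 0 <= joint Ups mu.
Proof. by apply: prodr_ge0 => r _; exact: pmf_ge0. Qed.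

Lemma trans_ge0 x a y : 0 <= trans Ups x a y.
Proof. by rewrite /trans; case: ifP => // _; exact: joint_ge0. Qed.

Lemma trans_sum1 x a : a \in enabled x ->
  (\esum_(y in [set: state W]) (trans Ups x a y)%:E = 1)%E.
Proof.
move=> xa; rewrite -(joint_sum1 Ups).
pose next mu : state W := (succ x.1 a mu, mu).
transitivity (\esum_(y in range next) (trans Ups x a y)%:E)%E; last first.
  rewrite esum_image; last by move=> mu mu' _ _ [].
  by apply: eq_esum => mu _; rewrite /trans xa /= eqxx.
rewrite [RHS]esum_mkcond; apply: eq_esum => y _; case: ifPn => //.
rewrite /trans xa/=; case: eqP => // e /negP[]; rewrite inE; exists y.2 => //.
by rewrite /next -e -surjective_pairing.
Qed.

Lemma history_rcons x s y :
  history Ups x (rcons s y) =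
  history Ups x s && [exists a, 0 < trans Ups (last x s) a y].
Proof. by rewrite /history rcons_path. Qed.

Lemma step_prob_ge0 sigma x s y : history Ups x s -> 0 <= step_prob sigma x s y.
Proof.
by move=> h; apply: sumr_ge0 => a _; rewrite mulr_ge0 ?choice_prob_ge0 ?trans_ge0.
Qed.

Lemma step_prob0 sigma x s y :
  history Ups x s -> ~~ history Ups x (rcons s y) -> step_prob sigma x s y = 0.
Proof.
rewrite history_rcons => -> /= /existsPn h; apply: big1 => a _.
have := h a; rewrite lt_neqAle trans_ge0 andbT negbK => /eqP <-.
by rewrite mulr0.
Qed.

Lemma step_prob_sum1 sigma x s : history Ups x s ->
  (\esum_(y in [set: state W]) (step_prob sigma x s y)%:E = 1)%E.
Proof.
move=> h; under eq_esum do rewrite /step_prob -sumEFin.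
rewrite esum_sum; last first.
  by move=> y a _ _; rewrite lee_fin mulr_ge0 ?choice_prob_ge0 ?trans_ge0.
transitivity (\sum_a (sigma (x :: s) a)%:E)%E; last first.
  by rewrite sumEFin choice_prob_sum1.
apply: eq_bigr => a _; under eq_esum do rewrite EFinM.
rewrite esum_scale ?choice_prob_ge0//; last by move=> y; rewrite lee_fin trans_ge0.
have [xa|xa] := boolP (a \in enabled (last x s)); first by rewrite trans_sum1// mule1.
by rewrite choice_prob_enabled// mul0e.
Qed.

Lemma prefix_prob_rcons sigma c x s y :
  prefix_prob sigma c (x :: rcons s y) =
  prefix_prob sigma c (x :: s) * step_prob sigma x s y.
Proof.
rewrite /= size_rcons big_ord_recr /= mulrA -cats1 take_size_cat//.
rewrite nth_cat ltnn subnn /=; congr (_ * _ * _); apply: eq_bigr => i _.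
by rewrite nth_cat ltn_ord take_cat ltn_ord.
Qed.

Lemma prefix_prob_history sigma c x s :
  0 <= prefix_prob sigma c (x :: s) /\
  (~~ history Ups x s -> prefix_prob sigma c (x :: s) = 0).
Proof.
elim/last_ind: s => [|s y [IH1 IH2]].
  by rewrite /= big_ord0 mulr1 ler0n.
rewrite prefix_prob_rcons; have [h|h] := boolP (history Ups x s).
  split; first by rewrite mulr_ge0 ?step_prob_ge0.
  by move=> h'; rewrite step_prob0 ?mulr0.
by rewrite IH2// mul0r.
Qed.

Lemma prefix_prob_ge0 sigma c s : 0 <= prefix_prob sigma c s.
Proof.
by case: s => [|x s]; [rewrite ler01|case: (prefix_prob_history sigma c x s)].
Qed.

Lemma prefix_prob_consistent sigma c s :
  (\esum_(y in [set: state W]) (prefix_prob sigma c (rcons s y))%:E =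
   (prefix_prob sigma c s)%:E)%E.
Proof.
case: s => [|x s].
  transitivity (\esum_(y in [set init c]) (1%:E : \bar R))%E; last first.
    by rewrite esum_set1.
  rewrite [RHS]esum_mkcond; apply: eq_esum => y _ /=.
  rewrite big_ord0 mulr1; case: ifPn => [|/negP]; rewrite inE /= => h.
    by rewrite h eqxx.
  by case: eqP.
transitivity (\esum_(y in [set: state W])
    ((prefix_prob sigma c (x :: s))%:E * (step_prob sigma x s y)%:E))%E.
  by apply: eq_esum => y _; rewrite -EFinM -prefix_prob_rcons.
have [h|h] := boolP (history Ups x s); last first.
  rewrite (prefix_prob_history sigma c x s).2//.
  by apply: esum1 => y _; rewrite mul0e.
rewrite esum_scale ?step_prob_sum1 ?mule1 ?prefix_prob_ge0// => y.
by rewrite lee_fin step_prob_ge0.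
Qed.

Lemma run_probability_exists sigma c : {P : probability (runs W) R |
  forall s, P (cylinder s) = (prefix_prob sigma c s)%:E}.
Proof.
apply/cid.
exact: (@consistent_family_probability R (state W) pickle
  (pcan_inj pickleK) (prefix_prob sigma c) erefl (prefix_prob_ge0 sigma c)
  (prefix_prob_consistent sigma c)).
Qed.

(* By run_probability_cylinder and cylinder_probability_unique this is the unique
   measure induced by sigma on the runs starting in init c. *)
Definition run_probability sigma c : probability (runs W) R :=
  sval (run_probability_exists sigma c).

Lemma run_probability_cylinder sigma c s :
  run_probability sigma c (cylinder s) = (prefix_prob sigma c s)%:E.
Proof. by rewrite /run_probability; case: run_probability_exists. Qed.

Lemma scheduler_inhabited : inhabited (scheduler Ups).
Proof.
pose a0 (x : state W) := if nondet x then Th else Tau.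
constructor; exists (fun s a => if s is x :: s' then (a == a0 (last x s'))%:R else 0).
- by move=> x s _ a; rewrite ler0n.
- move=> x s _ a; case: eqP => // ->; rewrite /a0 inE /=.
  by case: (nondet _); move=> /negP[].
- move=> x s _; rewrite (bigD1 (a0 (last x s)))//= eqxx big1 ?addr0//.
  by move=> a /negbTE ->.
Qed.

End run_probability.

Section termination_time.
Context (R : realType) (W : program) (Ups : sampling R W).
Local Open Scope ereal_scope.

Definition term_time (w : runs W) : \bar R :=
  ereal_inf [set n%:R%:E | n in [set n | (w n).1 = [::]]].

Definition expected_time (sigma : scheduler Ups) (c : nt_elem W) : \bar R :=
  \int[run_probability sigma c]_w term_time w.

Definition sup_time (c : stack_elem W) : \bar R :=
  if insub c is Some c' then
    ereal_sup [set expected_time sigma c' | sigma in [set: scheduler Ups]]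
  else 0.

Record ranking_measure_function (h : stack_elem W -> \bar R) (eps : R) : Prop :=
  RankingMeasureFunction {
  rmf_eps_gt0 : (0 < eps)%R;
  rmf_ge0 : forall c, 0 <= h c;
  rmf_out : forall f (nu : valuation (pvar f)), h (elem (lout f) nu) = 0;
  rmf_assign : forall f (l : label f) u l', l != lout f ->
    code l = Assign u l' -> forall nu,
    eps%:E + \esum_(mu in [set mu | (0 < joint Ups mu)%R])
               ((joint Ups mu)%:E * h (elem l' (u nu mu)))
      <= h (elem l nu);
  rmf_call : forall f (l : label f) g v l', l != lout f ->
    code l = @Call _ _ _ _ f g v l' -> forall nu,
    eps%:E + h (elem (lin g) (v nu)) + h (elem l' nu) <= h (elem l nu);
  rmf_branch : forall f (l : label f) phi l1 l2, l != lout f ->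
    code l = Branch _ phi l1 l2 -> forall nu,
    (sat nu phi)%:R%:E * h (elem l1 nu)
      + (sat nu (Neg phi))%:R%:E * h (elem l2 nu) + eps%:E <= h (elem l nu);
  rmf_nondet : forall f (l : label f) l1 l2, l != lout f ->
    code l = Nondet _ _ l1 l2 -> forall nu,
    maxe (h (elem l1 nu)) (h (elem l2 nu)) + eps%:E <= h (elem l nu)
}.

End termination_time.

(* Main.v *)
(* Extend h to configurations by H w := sum of h over the letters of w. By (C1)-(C5),
   from a nonempty configuration every enabled action decreases the expected value of
   H by at least eps, hence so does every scheduler's mixture of actions. Telescoping
   this along the histories gives eps * sum_(n < N) P (w_n nonempty) <= H(w_0) = h c
   for every N, and T <= sum_n 1_(w_n nonempty) pointwise. Working with these
   probabilities rather than with the integrals of H avoids subtracting infinite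
   values. *)

Require Import Defs.
From mathcomp Require Import all_boot all_order all_algebra.
From mathcomp Require Import all_classical all_reals all_analysis.
From mathcomp Require Import measurable_realfun.
Set Implicit Arguments.
Unset Strict Implicit.
Unset Printing Implicit Defensive.
Import Order.TTheory GRing.Theory Num.Theory.
Local Open Scope classical_set_scope.
Local Open Scope ring_scope.
Local Open Scope ereal_scope.

(* Unlike ge0_le_integral, no measurability is required: the integral of a
   nonnegative function is a supremum over the simple functions below it. *)
Lemma le_nonneg_integral d (T : measurableType d) (R : realType)
    (mu : {measure set T -> \bar R}) (f g : T -> \bar R) :
  (forall x, 0 <= f x) -> (forall x, f x <= g x) ->
  \int[mu]_x f x <= \int[mu]_x g x.
Proof.
move=> f0 fg.
have g0 x : 0 <= g x by exact: le_trans (f0 x) (fg x).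
rewrite !ge0_integralTE//; apply: ge_ereal_sup => _ [k kf <-]; apply: ereal_sup_ubound.
by exists k => // x; exact: le_trans (kf x) (fg x).
Qed.

(** As an inequality this is trivial for [k = +oo]; for finite [k] the constant comes out of the
    sum. *)
Lemma esum_scaler_le (R : realType) (T : choiceType) (p : T -> R) (k : \bar R) :
  (forall t, 0 <= p t)%R -> \esum_(t in [set: T]) (p t)%:E = 1 -> 0 <= k ->
  \esum_(t in [set: T]) ((p t)%:E * k) <= k.
Proof.
move=> p0 p1; case: k => [k||]; rewrite ?leey//.
rewrite lee_fin => k0; under eq_esum do rewrite muleC.
by rewrite esum_scale// ?p1 ?mule1.
Qed.

(** * Events determined by one coordinate of a run *)

Section runs_measure.
Context (R : realType) (W : program).
Local Notation state := (state W).
Local Notation runs := (runs W).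

Lemma measurable_cylinder (s : seq state) : measurable (cylinder s : set runs).
Proof. by apply: sub_sigma_algebra; exists s. Qed.

(** Since [state] is countable, the event is a countable union of cylinders, those of length [n.+1]
    whose last letter lies in [B]; hence [B] may be arbitrary. *)
Lemma measurable_coordinate (n : nat) (B : set state) :
  measurable [set w : runs | B (w n)].
Proof.
rewrite (_ : [set w : runs | _] =
    \bigcup_(s : seq state) (if `[< size s = n.+1 /\ B (nth point s n) >]
                             then cylinder s else set0)).
  apply: countable_bigcupT_measurable; first exact: countableP.
  by move=> s; case: ifP => // _; exact: measurable_cylinder.
apply/seteqP; split=> [w Bw|w [s _]].
  exists (mkseq w n.+1) => //; rewrite ifT.
    by rewrite /cylinder /mkset size_mkseq.
  by apply/asboolP; rewrite size_mkseq nth_mkseq.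
case: asboolP => // -[sn Bs] ws /=.
by move: Bs; rewrite -ws sn nth_mkseq.
Qed.

Lemma cylinder_last (x : state) (s : seq state) (w : nat -> state) :
  cylinder (x :: s) w -> w (size s) = last x s.
Proof.
move=> /(congr1 (fun t => nth x t (size s))); rewrite nth_mkseq// => ->.
exact: (nth_last x (x :: s)).
Qed.

Lemma cylinder_rcons (s : seq state) (y : state) :
  cylinder (rcons s y) = cylinder s `&` [set w : nat -> state | w (size s) = y].
Proof.
have S w : mkseq w (size s).+1 = rcons (mkseq w (size s)) (w (size s)).
  by rewrite /mkseq -addn1 iotaD map_cat cats1.
apply/seteqP; split=> w; rewrite /cylinder /mkset size_rcons S.
  by move=> /rcons_inj[].
by move=> [-> <-].
Qed.

Lemma measure_coordinate (mu : {measure set runs -> \bar R}) (n : nat) (A : set runs) :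
  measurable A ->
  mu A = \esum_(y in [set: state]) mu (A `&` [set w : runs | w n = y]).
Proof.
move=> mA.
pose B y := A `&` [set w : runs | w n = y].
have mB y : measurable (B y).
  by apply: measurableI => //; exact: (measurable_coordinate n [set y]).
(* Countable additivity is available for sequences of sets, so the pieces [B y] are indexed by the
   codes of the states, and naturals that code no state get the empty set. *)
pose K := [set k | exists y : state, k = pickle y].
pose D k := if unpickle k is Some y then B y else set0.
rewrite (@reindex_esum _ _ _ K _ (fun k => odflt (point : state) (unpickle k)));
  last first.
  split=> // [k k'|y _].
    by rewrite !inE => -[y ->] [y' ->]; rewrite !pickleK /= => ->.
  by exists (pickle y); [exists y|rewrite pickleK].
rewrite esum_mkcond -nneseries_esumT; last by move=> k; case: ifP.
transitivity (mu (\bigcup_k if k \in K then D k else set0)).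
  congr (mu _); apply/seteqP; split=> [w Aw|w [k _]]; last first.
    by case: ifP => // _; rewrite /D; case: unpickle => // y [].
  exists (pickle (w n)) => //; rewrite ifT; last by rewrite inE; exists (w n).
  by rewrite /D pickleK.
rewrite measure_semi_bigcup //.
- apply: eq_eseriesr => k _; case: ifPn; last by rewrite measure0.
  by rewrite inE => -[y ->]; rewrite /D pickleK.
- move=> k; case: ifP => // _; rewrite /D.
  by case: unpickle.
- move=> k k' _ _ [w []]; case: ifPn => //; rewrite inE => -[y ->].
  case: ifPn => //; rewrite inE => -[y' ->].
  by rewrite /D !pickleK => -[_ /= <-] [_ /= <-].
- apply: bigcupT_measurable => k; case: ifP => // _; rewrite /D.
  by case: unpickle.
Qed.

End runs_measure.

(** * One-step decrease of the rank of configurations *)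

Section ranking.
Context (R : realType) (W : program) (Ups : sampling R W).
Context (h : stack_elem W -> \bar R) (eps : R).
Context (rmf_h : ranking_measure_function Ups h eps).

Definition config_rank (w : config W) : \bar R := \sum_(c <- w) h (val c).

Local Notation H := config_rank.

Lemma h_ge0 c : 0 <= h c. Proof. exact: (rmf_ge0 rmf_h). Qed.
Local Hint Resolve h_ge0 : core.

Lemma eps_ge0 : 0 <= eps%:E.
Proof. by rewrite lee_fin ltW// (rmf_eps_gt0 rmf_h). Qed.

Lemma config_rank_ge0 w : 0 <= H w.
Proof. exact: sume_ge0. Qed.
Local Hint Resolve config_rank_ge0 : core.

Lemma joint_fin_ge0 mu : 0 <= (joint Ups mu)%:E.
Proof. by rewrite lee_fin joint_ge0. Qed.
Local Hint Resolve joint_fin_ge0 : core.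

(** [word] drops terminal elements; by (C1) this loses no rank. *)
Lemma config_rank_word c : H (word c) = h c.
Proof.
rewrite /H /word; case: insubP => [c' _ <-|]; first by rewrite big_seq1.
rewrite negbK big_nil; case: c => f [l nu] /eqP /= ->.
by rewrite (rmf_out rmf_h).
Qed.

Lemma esum_joint_scaler_le k : 0 <= k ->
  \esum_(mu in [set: valuation (svar W)]) ((joint Ups mu)%:E * k) <= k.
Proof. by apply: esum_scaler_le; [exact: joint_ge0|exact: joint_sum1]. Qed.

(** Which actions are enabled depends only on the top letter, so [init c] stands for every state
    with top [c]. *)
Lemma exec_rank (c : nt_elem W) (a : action) : a \in enabled (init c) ->
  eps%:E + \esum_(mu in [set: valuation (svar W)])
    ((joint Ups mu)%:E * H (exec c a mu)) <= h (val c).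
Proof.
case: c => -[f [l nu]] /= l_out; rewrite inE /nondet /= /exec /=.
case E : (Defs.code l) => [u l'|g v l'|phi l1 l2|l1 l2] ea.
- apply: le_trans (rmf_assign rmf_h l_out E nu).
  (* (C2) sums over samples of positive probability; the others contribute zero. *)
  rewrite leeD2l// [leRHS]esum_mkcond; apply: le_esum => mu _.
  rewrite config_rank_word; case: ifPn => //; rewrite notin_setE /= => /negP.
  rewrite -leNgt => j0; have -> : joint Ups mu = 0%R.
    by apply/eqP; rewrite eq_le j0 joint_ge0.
  by rewrite mul0e.
(* From this case on the successor does not depend on the sample, so averaging gives at most its
   rank. *)
- apply: le_trans (rmf_call rmf_h l_out E nu).
  rewrite -addeA leeD2l// /config_rank big_cons -/(config_rank _) config_rank_word.
  by apply: esum_joint_scaler_le; rewrite adde_ge0.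
- apply: le_trans (rmf_branch rmf_h l_out E nu).
  rewrite [leLHS]addeC leeD2r//.
  apply: (le_trans (esum_joint_scaler_le (config_rank_ge0 _))).
  by rewrite config_rank_word /=; case: sat; rewrite /= mul1e mul0e ?adde0 ?add0e.
- apply: le_trans (rmf_nondet rmf_h l_out E nu).
  rewrite [leLHS]addeC leeD2r//.
  apply: (le_trans (esum_joint_scaler_le (config_rank_ge0 _))).
  rewrite config_rank_word le_max; by case: a {ea}; rewrite /= lexx ?orbT.
Qed.

(** The guaranteed decrease, set to zero on the absorbing empty configuration so that one inequality
    covers all states. *)
Definition step_cost (x : state W) : \bar R := (eps * (x.1 != [::])%:R)%:E.

Lemma step_cost_ge0 x : 0 <= step_cost x.
Proof. by rewrite lee_fin mulr_ge0// ?ler0n// ltW// (rmf_eps_gt0 rmf_h). Qed.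
Local Hint Resolve step_cost_ge0 : core.

Lemma trans_fin_ge0 x a y : 0 <= (trans Ups x a y)%:E.
Proof. by rewrite lee_fin trans_ge0. Qed.
Local Hint Resolve trans_fin_ge0 : core.

Lemma trans_rank (x : state W) (a : action) : a \in enabled x ->
  step_cost x + \esum_(y in [set: state W]) ((trans Ups x a y)%:E * H y.1) <= H x.1.
Proof.
move=> xa; pose next mu : state W := (Defs.succ x.1 a mu, mu).
(* Transitions under [a] are supported on the image of the injective map [next], so the sum over
   states becomes a sum over samples. *)
have -> : \esum_(y in [set: state W]) ((trans Ups x a y)%:E * H y.1) =
    \esum_(mu in [set: valuation (svar W)])
      ((joint Ups mu)%:E * H (Defs.succ x.1 a mu)).
  transitivity (\esum_(y in range next) ((trans Ups x a y)%:E * H y.1)); last first.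
    rewrite esum_image; last by move=> mu mu' _ _ [].
    by apply: eq_esum => mu _; rewrite /trans xa /= eqxx.
  rewrite [RHS]esum_mkcond; apply: eq_esum => y _; case: ifPn => //.
  rewrite /trans xa/=; case: eqP => [e /negP[]|]; last by rewrite mul0e.
  by rewrite inE; exists y.2 => //; rewrite /next -e -surjective_pairing.
case: x xa @next => -[|c w] mu0 xa _; rewrite /step_cost /=.
  rewrite mulr0 add0e esum1// => mu _.
  by rewrite /H big_nil mule0.
rewrite mulr1 /H big_cons -/(H _).
(* The stack [w] below the top is untouched, so its rank splits off on both sides. *)
under eq_esum do rewrite big_cat /= -/(H _) -/(H w) ge0_muleDr//.
rewrite esumD; try by move=> mu _; rewrite mule_ge0.
rewrite addeA leeD//; last exact: esum_joint_scaler_le.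
exact: (exec_rank xa).
Qed.

Lemma step_rank (sigma : scheduler Ups) (x : state W) (s : seq (state W)) :
  history Ups x s ->
  step_cost (last x s) +
    \esum_(y in [set: state W]) ((step_prob sigma x s y)%:E * H y.1)
  <= H (last x s).1.
Proof.
move=> hs; set z := last x s.
have s0 a : (0 <= sigma (x :: s) a)%R by exact: choice_prob_ge0.
have s1 : \sum_a (sigma (x :: s) a)%:E = 1.
  by rewrite sumEFin choice_prob_sum1.
have split1 k : 0 <= k -> \sum_a ((sigma (x :: s) a)%:E * k) = k.
  by move=> k0; rewrite -ge0_sume_distrl ?s1 ?mul1e// => a _; rewrite lee_fin.
have -> : \esum_(y in [set: state W]) ((step_prob sigma x s y)%:E * H y.1) =
    \sum_a ((sigma (x :: s) a)%:E *
      \esum_(y in [set: state W]) ((trans Ups z a y)%:E * H y.1)).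
  transitivity (\esum_(y in [set: state W])
      \sum_a ((sigma (x :: s) a)%:E * ((trans Ups z a y)%:E * H y.1))).
    apply: eq_esum => y _; rewrite /step_prob -sumEFin ge0_sume_distrl.
      by apply: eq_bigr => a _; rewrite EFinM muleA.
    by move=> a _; rewrite lee_fin mulr_ge0 ?trans_ge0.
  rewrite esum_sum; last by move=> y a _ _; rewrite !mule_ge0// lee_fin.
  by apply: eq_bigr => a _; rewrite esum_scale// => y; rewrite mule_ge0.
(* Cost and rank are written as averages over the actions, which reduces the claim to single
   actions; disabled ones have weight zero. *)
rewrite -[X in X + _]split1// -[leRHS]split1// -big_split /=.
apply: lee_sum => a _; have [za|za] := boolP (a \in enabled z).
  rewrite -ge0_muleDr//; last by apply: esum_ge0 => y _; rewrite mule_ge0.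
  by rewrite lee_wpmul2l ?lee_fin ?trans_rank.
by rewrite choice_prob_enabled// !mul0e adde0.
Qed.

(** * Telescoping along prefixes *)

Definition running (n : nat) : set (runs W) := [set w | (w n).1 != [::]].

Lemma measurable_running n : measurable (running n).
Proof. exact: (measurable_coordinate n [set x | x.1 != [::]]). Qed.
Local Hint Resolve measurable_running : core.

(** Induction on [N] for all prefixes at once: the first summand is paid by [step_cost], the later
    ones by the extensions of the prefix by one state. *)
Lemma prefix_rank (sigma : scheduler Ups) (c : nt_elem W) (N : nat)
    (x : state W) (s : seq (state W)) :
  \sum_(size s <= n < size s + N)
    (eps%:E * run_probability sigma c (cylinder (x :: s) `&` running n))
  <= (prefix_prob sigma c (x :: s))%:E * H (last x s).1.
Proof.
set P := run_probability sigma c.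
elim: N s => [|N IH] s.
  by rewrite addn0 big_geq// mule_ge0// lee_fin prefix_prob_ge0.
(* [step_rank] speaks of histories only; any other prefix has probability zero, and both sides
   vanish. *)
have [hs|hs] := boolP (history Ups x s); last first.
  have p0 := (prefix_prob_history sigma c x s).2 hs.
  rewrite p0 mul0e big1// => n _.
  suff -> : P (cylinder (x :: s) `&` running n) = 0 by rewrite mule0.
  apply: (subset_measure0 _ _ _ (_ : P (cylinder (x :: s)) = 0)) => //.
  - by apply: measurableI => //; exact: measurable_cylinder.
  - exact: measurable_cylinder.
  - by rewrite run_probability_cylinder p0.
rewrite big_ltn ?addnS ?ltnS ?leq_addr//.
apply: le_trans (lee_wpmul2l _ (step_rank sigma hs)); last first.
  by rewrite lee_fin prefix_prob_ge0.
have p0 : 0 <= (prefix_prob sigma c (x :: s))%:E by rewrite lee_fin prefix_prob_ge0.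
have sH0 y : 0 <= (step_prob sigma x s y)%:E * H y.1.
  by rewrite mule_ge0// lee_fin step_prob_ge0.
rewrite ge0_muleDr//; last exact: esum_ge0.
apply: leeD.
  rewrite -run_probability_cylinder -/P.
  (* The prefix [x :: s] fixes the state at time [size s], so [running (size s)] contains all of the
     cylinder or none of it. *)
  have -> : cylinder (x :: s) `&` running (size s) =
      if (last x s).1 != [::] then cylinder (x :: s) else set0.
    apply/seteqP; split=> w /= => [[ws]|].
      by rewrite /running /mkset (cylinder_last ws) => ->.
    by case: ifPn => // l0 ws; split=> //; rewrite /running/= (cylinder_last ws).
  rewrite /step_cost; case: ifPn => _; last by rewrite measure0 mulr0 !mule0.
  by rewrite mulr1 muleC.
rewrite -esum_scale ?prefix_prob_ge0//.
(* The later summands are split by the state at time [(size s).+1], the first one not fixed by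
   [x :: s]. *)
under eq_bigr => n _.
  rewrite (measure_coordinate P (size s).+1); last first.
    by apply: measurableI => //; exact: measurable_cylinder.
  rewrite -esum_scale; last 2 first.
  - by rewrite ltW// (rmf_eps_gt0 rmf_h).
  - by [].
  over.
rewrite -esum_sum; last by move=> y n _ _; rewrite mule_ge0// eps_ge0.
apply: le_esum => y _.
rewrite muleA -EFinM -prefix_prob_rcons.
have := IH (rcons s y); rewrite size_rcons last_rcons addSn.
apply: le_trans; rewrite le_eqVlt; apply/orP; left; apply/eqP.
apply: eq_bigr => n _; congr (_ * P _).
by rewrite -rcons_cons cylinder_rcons setIAC.
Qed.

(** * From probabilities of running to the expected termination time *)

Lemma expected_time_rank (sigma : scheduler Ups) (c : nt_elem W) :
  eps%:E * expected_time sigma c <= h (val c).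
Proof.
set P := run_probability sigma c.
have PI : P (cylinder [:: init c]) = 1.
  by rewrite run_probability_cylinder /= eqxx big_ord0 mulr1.
(* The starting cylinder has full measure, so intersecting with it changes nothing. *)
have Prun n : P (cylinder [:: init c] `&` running n) = P (running n).
  have mI : measurable (cylinder [:: init c] : set (runs W)).
    exact: measurable_cylinder.
  rewrite [RHS](measureDI _ (measurable_running n) mI) setIC.
  rewrite [X in _ = X + _](_ : _ = 0) ?add0e//.
  apply: (subset_measure0 _ _ _ (_ : P (~` cylinder [:: init c]) = 0)).
  - exact: measurableD.
  - exact: measurableC.
  - by move=> w [].
  - by rewrite probability_setC// PI subee.
have eT : expected_time sigma c <= \sum_(n <oo) P (running n).
  apply: (@le_trans _ _ (\int[P]_w \sum_(n <oo) (\1_(running n) w)%:E)).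
    apply: le_nonneg_integral => w.
      by apply: le_ereal_inf_tmp => _ [n _ <-]; rewrite lee_fin ler0n.
    have f0 n : 0 <= (\1_(running n) w : R)%:E by rewrite lee_fin.
    have le_series m : (forall k, (k < m)%N -> (w k).1 != [::]) ->
        m%:R%:E <= \sum_(n <oo) (\1_(running n) w : R)%:E.
      move=> wm; apply: le_trans (nneseries_lim_ge m _) => //.
      rewrite sumEFin lee_fin (eq_big_nat _ _ (F2 := fun=> 1%R)).
        by rewrite big_const_nat subn0 iter_addr_0.
      by move=> k /andP[_ km]; rewrite indicE mem_set//; exact: wm.
    (* On a terminating run [m] is the first empty time, and the [m] earlier indicators equal one;
       otherwise the series exceeds every natural number. *)
    have [term|nw] := pselect (exists n, (w n).1 == [::]).
      have [m wm m_min] := ex_minnP term.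
      apply: le_trans (le_series m _).
        by apply: ereal_inf_lbound; exists m => //; apply/eqP.
      by move=> k km; apply/negP => /m_min; rewrite leqNgt km.
    rewrite (_ : \sum_(n <oo) _ = +oo) ?leey//; apply: eq_infty => r.
    apply: (@le_trans _ _ (Num.bound `|r|%R)%:R%:E).
      by rewrite lee_fin ltW// (le_lt_trans (ler_norm _))// archi_boundP.
    by apply: le_series => k _; apply/negP => wk; apply: nw; exists k.
  rewrite integral_nneseries//.
    apply: lee_nneseries => n _; last by rewrite integral_indic// setIT.
    by rewrite integral_ge0// => w _; rewrite lee_fin.
  move=> n; apply/measurable_EFinP; exact: measurable_indic.
apply: le_trans (lee_wpmul2l eps_ge0 eT) _.
(* Each partial sum is bounded by [prefix_rank] for the prefix consisting of [init c] alone. *)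
rewrite -nneseriesZl//; apply: lime_le.
  by apply: is_cvg_nneseries => n _ _; rewrite mule_ge0// eps_ge0.
apply: nearW => N.
have := prefix_rank sigma c N (init c) [::].
rewrite /= eqxx big_ord0 mulr1 mul1e /H big_seq1 add0n.
by under eq_bigr do rewrite Prun.
Qed.

End ranking.

Theorem lemma1 (R : realType) (W : program) (Ups : sampling R W)
    (h : stack_elem W -> \bar R) (eps : R)
    (rmf_h : ranking_measure_function Ups h eps) (c : stack_elem W) :
  sup_time Ups c <= h c / eps%:E.
Proof.
have eps0 := rmf_eps_gt0 rmf_h.
rewrite inver gt_eqF// lee_pdivlMr// /sup_time; case: insubP => [c' _ <-|_].
  rewrite -lee_pdivlMr//; apply: ge_ereal_sup => _ [sigma _ <-].
  by rewrite lee_pdivlMr// muleC; exact: expected_time_rank.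
rewrite mul0e; exact: rmf_ge0 rmf_h _.
Qed.
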